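(* Let $\mathbf{U}^{sw},\mathbf{U}^{se},\mathbf{U}^{nw},\mathbf{U}^{ne}$ be four admissible two-dimensional ideal MHD states defining a 2-D Riemann problem, with $B_x^{nw}=B_x^{ne}$, $B_x^{sw}=B_x^{se}$, $B_y^{sw}=B_y^{nw}$, $B_y^{se}=B_y^{ne}$. Let $\tilde E_z$ be the vertex electric field produced by the 2-D HLL solver described in the context, and let $\hat E_z^{x}$, $\hat E_z^{y}$ be the electric fields of the 1-D HLL solvers in the $x$ and $y$ directions described in the context. If the 2-D Riemann data has jumps only along one coordinate direction, then the 2-D solver reduces to the 1-D solver as far as the electric field is concerned. That is: (1) if $\mathbf{U}^{nw}=\mathbf{U}^{sw}=\mathbf{U}^L$ and $\mathbf{U}^{ne}=\mathbf{U}^{se}=\mathbf{U}^R$ (so that $B_x^L=B_x^R$), then $\tilde E_z=\hat E_z^{x}(\mathbf{U}^L,\mathbf{U}^R)$; (2) if $\mathbf{U}^{sw}=\mathbf{U}^{se}=\mathbf{U}^D$ and $\mathbf{U}^{nw}=\mathbf{U}^{ne}=\mathbf{U}^U$ (so that $B_y^D=B_y^U$), then $\tilde E_z=\hat E_z^{y}(\mathbf{U}^D,\mathbf{U}^U)$.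
   Context: **States.** An MHD state is a vector $\mathbf{U}=(\rho,\rho v_x,\rho v_y,\rho v_z,\mathcal{E},B_x,B_y,B_z)\in\mathbb{R}^8$. Here $\rho$ is the density, $(v_x,v_y,v_z)$ the velocity, $(B_x,B_y,B_z)$ the magnetic field, and $\mathcal{E}=\frac{p}{\gamma-1}+\frac12\rho|v|^2+\frac12|B|^2$ the total energy with pressure $p$ ($\gamma>1$ is a fixed constant). The state is admissible if $\rho>0$ and $p>0$. The $z$-component of the electric field of a state is $E_z(\mathbf{U})=v_yB_x-v_xB_y$. Superscripts on $B_x,B_y,E_z$ indicate the state at which they are evaluated; e.g. $E_z^{sw}=E_z(\mathbf{U}^{sw})$. **Wave speed estimates.** For each direction $d\in\{x,y\}$, real-valued functions $\lambda^{\min}_d(\mathbf{U}^1,\mathbf{U}^2)<\lambda^{\max}_d(\mathbf{U}^1,\mathbf{U}^2)$ of two states are given. They estimate the slowest and fastest wave speeds in the 1-D Riemann problem in direction $d$ with left (bottom) state $\mathbf{U}^1$ and right (top) state $\mathbf{U}^2$. **1-D HLL electric field in $x$.** For states $\mathbf{U}^L,\mathbf{U}^R$ with $B_x^L=B_x^R$, put $S_L=\lambda_x^{\min}(\mathbf{U}^L,\mathbf{U}^R)$ and $S_R=\lambda_x^{\max}(\mathbf{U}^L,\mathbf{U}^R)$, and define $$\hat E_z^{x}(\mathbf{U}^L,\mathbf{U}^R)=\begin{cases}E_z^L & S_L>0\\ E_z^R & S_R<0\\ \dfrac{S_RE_z^L-S_LE_z^R-S_LS_R(B_y^R-B_y^L)}{S_R-S_L}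 & \text{otherwise.}\end{cases}$$ **1-D HLL electric field in $y$.** For states $\mathbf{U}^D$ (bottom) and $\mathbf{U}^U$ (top) with $B_y^D=B_y^U$, put $S_D=\lambda_y^{\min}(\mathbf{U}^D,\mathbf{U}^U)$ and $S_U=\lambda_y^{\max}(\mathbf{U}^D,\mathbf{U}^U)$, and define $$\hat E_z^{y}(\mathbf{U}^D,\mathbf{U}^U)=\begin{cases}E_z^D & S_D>0\\ E_z^U & S_U<0\\ \dfrac{S_UE_z^D-S_DE_z^U+S_DS_U(B_x^U-B_x^D)}{S_U-S_D} & \text{otherwise.}\end{cases}$$ **2-D HLL vertex electric field.** The 2-D Riemann data is $\mathbf{U}^{sw}$ for $x<0,y<0$; $\mathbf{U}^{nw}$ for $x<0,y>0$; $\mathbf{U}^{se}$ for $x>0,y<0$; $\mathbf{U}^{ne}$ for $x>0,y>0$. The normal magnetic components are continuous: $B_x^{nw}=B_x^{ne}$, $B_x^{sw}=B_x^{se}$, $B_y^{sw}=B_y^{nw}$, $B_y^{se}=B_y^{ne}$. Define the speeds $$S_w=\min\{\lambda_x^{\min}(\mathbf{U}^{sw},\mathbf{U}^{se}),\lambda_x^{\min}(\mathbf{U}^{nw},\mathbf{U}^{ne})\},\quad S_e=\max\{\lambda_x^{\max}(\mathbf{U}^{sw},\mathbf{U}^{se}),\lambda_x^{\max}(\mathbf{U}^{nw},\mathbf{U}^{ne})\},$$ $$S_s=\min\{\lambda_y^{\min}(\mathbf{U}^{sw},\mathbf{U}^{nw}),\lambda_y^{\min}(\mathbf{U}^{se},\mathbf{U}^{ne})\},\quad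 S_n=\max\{\lambda_y^{\max}(\mathbf{U}^{sw},\mathbf{U}^{nw}),\lambda_y^{\max}(\mathbf{U}^{se},\mathbf{U}^{ne})\}.$$ The four 1-D quantities are $$E_z^{n*}=\hat E_z^x(\mathbf{U}^{nw},\mathbf{U}^{ne}),\quad E_z^{s*}=\hat E_z^x(\mathbf{U}^{sw},\mathbf{U}^{se}),\quad E_z^{*e}=\hat E_z^y(\mathbf{U}^{se},\mathbf{U}^{ne}),\quad E_z^{*w}=\hat E_z^y(\mathbf{U}^{sw},\mathbf{U}^{nw}),$$ $$B_x^{n*}=B_x^{ne}=B_x^{nw},\quad B_x^{s*}=B_x^{se}=B_x^{sw},\quad B_y^{*e}=B_y^{ne}=B_y^{se},\quad B_y^{*w}=B_y^{nw}=B_y^{sw}.$$ The magnetic field of the strongly interacting state is $$\begin{aligned}B_x^{**}=\tfrac{1}{2(S_e-S_w)(S_n-S_s)}\big[&2S_eS_nB_x^{ne}-2S_nS_wB_x^{nw}+2S_sS_wB_x^{sw}-2S_sS_eB_x^{se}\\&-S_e(E_z^{ne}-E_z^{se})+S_w(E_z^{nw}-E_z^{sw})-(S_e-S_w)(E_z^{n*}-E_z^{s*})\big],\end{aligned}$$ $$\begin{aligned}B_y^{**}=\tfrac{1}{2(S_e-S_w)(S_n-S_s)}\big[&2S_eS_nB_y^{ne}-2S_nS_wB_y^{nw}+2S_sS_wB_y^{sw}-2S_sS_eB_y^{se}\\&+S_n(E_z^{ne}-E_z^{nw})-S_s(E_z^{se}-E_z^{sw})+(S_n-S_s)(E_z^{*e}-E_z^{*w})\big].\end{aligned}$$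 Set $$\begin{aligned}E_z^{**}=\tfrac14(E_z^{n*}+E_z^{s*}+E_z^{*e}+E_z^{*w})&-\tfrac14S_n(B_x^{n*}-B_x^{**})-\tfrac14S_s(B_x^{s*}-B_x^{**})\\&+\tfrac14S_e(B_y^{*e}-B_y^{**})+\tfrac14S_w(B_y^{*w}-B_y^{**}).\end{aligned}$$ Finally, testing the conditions in the listed order (if / else-if), $$\tilde E_z=\begin{cases} E_z^{*w} & S_w>0\\ E_z^{*e} & S_e<0\\ E_z^{s*} & S_s>0\\ E_z^{n*} & S_n<0\\ E_z^{**} & \text{otherwise.}\end{cases}$$ *)

(* Defs.v *)
From mathcomp Require Import all_boot all_order all_algebra.
From mathcomp Require Import reals.

Set Implicit Arguments.
Unset Strict Implicit.
Unset Printing Implicit Defensive.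

Import Order.TTheory GRing.Theory Num.Theory.

Local Open Scope ring_scope.

(* Conserved variables (rho, rho v_x, rho v_y, rho v_z, energy, B_x, B_y, B_z). *)
Definition state (R : realType) := 'rV[R]_8.

Definition density (R : realType) (U : state R) : R := U 0 0.
Definition vx (R : realType) (U : state R) : R := U 0 1 / density U.
Definition vy (R : realType) (U : state R) : R := U 0 2 / density U.
Definition vz (R : realType) (U : state R) : R := U 0 3 / density U.
Definition energy (R : realType) (U : state R) : R := U 0 4.
Definition Bx (R : realType) (U : state R) : R := U 0 5.
Definition By (R : realType) (U : state R) : R := U 0 6.
Definition Bz (R : realType) (U : state R) : R := U 0 7.

Definition kinetic_energy (R : realType) (U : state R) : R :=
  density U * (vx U ^+ 2 + vy U ^+ 2 + vz U ^+ 2) / 2.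

Definition magnetic_energy (R : realType) (U : state R) : R :=
  (Bx U ^+ 2 + By U ^+ 2 + Bz U ^+ 2) / 2.

(* The equation of state solved for the pressure; see [energyE]. *)
Definition pressure (R : realType) (gamma : R) (U : state R) : R :=
  (gamma - 1) * (energy U - kinetic_energy U - magnetic_energy U).

Lemma energyE (R : realType) (gamma : R) (U : state R) : 1 < gamma ->
  energy U =
  pressure gamma U / (gamma - 1) + kinetic_energy U + magnetic_energy U.
Proof.
move=> gamma_gt1; have gamma1_neq0 : gamma - 1 != 0.
  by rewrite subr_eq0 gt_eqF.
by rewrite /pressure mulrC mulKf // addrAC !subrK.
Qed.

Definition admissible (R : realType) (gamma : R) (U : state R) : Prop :=
  0 < density U /\ 0 < pressure gamma U.

Definition Ez (R : realType) (U : state R) : R := vy U * Bx U - vx U * By U.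

Inductive direction := dir_x | dir_y.

(* Estimates of the slowest and fastest wave speeds of the 1-D Riemann problem
   in a given direction; the first state is the left (bottom) one. *)
Record wave_speeds (R : realType) := WaveSpeeds {
  lambda_min : direction -> state R -> state R -> R;
  lambda_max : direction -> state R -> state R -> R
}.

(* The ordering is only required on physical states, where wave speeds make
   sense. *)
Definition ordered_speeds (R : realType) (gamma : R) (lam : wave_speeds R) :
    Prop :=
  forall (d : direction) (U1 U2 : state R),
    admissible gamma U1 -> admissible gamma U2 ->
    lambda_min lam d U1 U2 < lambda_max lam d U1 U2.

(* Both 1-D fields are total functions; they are only meaningful when the
   component of B normal to the interface is continuous. *)
Definition hllEz_x (R : realType) (lam : wave_speeds R) (UL UR : state R) : R :=
  let SL := lambda_min lam dir_x UL UR in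
  let SR := lambda_max lam dir_x UL UR in
  if 0 < SL then Ez UL
  else if SR < 0 then Ez UR
  else (SR * Ez UL - SL * Ez UR - SL * SR * (By UR - By UL)) / (SR - SL).

Definition hllEz_y (R : realType) (lam : wave_speeds R) (UD UU : state R) : R :=
  let SD := lambda_min lam dir_y UD UU in
  let SU := lambda_max lam dir_y UD UU in
  if 0 < SD then Ez UD
  else if SU < 0 then Ez UU
  else (SU * Ez UD - SD * Ez UU + SD * SU * (Bx UU - Bx UD)) / (SU - SD).

Record riemann2d (R : realType) := Riemann2d {
  Usw : state R;
  Use : state R;
  Unw : state R;
  Une : state R
}.

Definition normal_continuous (R : realType) (Q : riemann2d R) : Prop :=
  [/\ Bx (Unw Q) = Bx (Une Q), Bx (Usw Q) = Bx (Use Q),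
      By (Usw Q) = By (Unw Q) & By (Use Q) = By (Une Q)].

Definition Sw (R : realType) (lam : wave_speeds R) (Q : riemann2d R) : R :=
  Num.min (lambda_min lam dir_x (Usw Q) (Use Q))
          (lambda_min lam dir_x (Unw Q) (Une Q)).

Definition Se (R : realType) (lam : wave_speeds R) (Q : riemann2d R) : R :=
  Num.max (lambda_max lam dir_x (Usw Q) (Use Q))
          (lambda_max lam dir_x (Unw Q) (Une Q)).

Definition Ss (R : realType) (lam : wave_speeds R) (Q : riemann2d R) : R :=
  Num.min (lambda_min lam dir_y (Usw Q) (Unw Q))
          (lambda_min lam dir_y (Use Q) (Une Q)).

Definition Sn (R : realType) (lam : wave_speeds R) (Q : riemann2d R) : R :=
  Num.max (lambda_max lam dir_y (Usw Q) (Unw Q))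
          (lambda_max lam dir_y (Use Q) (Une Q)).

(* The suffixes _n, _s, _e, _w stand for the superscripts n*, s*, *e, *w of the
   four 1-D interactions, and _ss for the superscript ** of the strongly
   interacting state. *)
Definition Ez_n (R : realType) (lam : wave_speeds R) (Q : riemann2d R) : R :=
  hllEz_x lam (Unw Q) (Une Q).
Definition Ez_s (R : realType) (lam : wave_speeds R) (Q : riemann2d R) : R :=
  hllEz_x lam (Usw Q) (Use Q).
Definition Ez_e (R : realType) (lam : wave_speeds R) (Q : riemann2d R) : R :=
  hllEz_y lam (Use Q) (Une Q).
Definition Ez_w (R : realType) (lam : wave_speeds R) (Q : riemann2d R) : R :=
  hllEz_y lam (Usw Q) (Unw Q).

(* By [normal_continuous] either of the two adjacent states could be used. *)
Definition Bx_n (R : realType) (Q : riemann2d R) : R := Bx (Une Q).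
Definition Bx_s (R : realType) (Q : riemann2d R) : R := Bx (Use Q).
Definition By_e (R : realType) (Q : riemann2d R) : R := By (Une Q).
Definition By_w (R : realType) (Q : riemann2d R) : R := By (Unw Q).

Definition Bx_ss (R : realType) (lam : wave_speeds R) (Q : riemann2d R) : R :=
  let: (sw, se, ss, sn) := (Sw lam Q, Se lam Q, Ss lam Q, Sn lam Q) in
  1 / (2 * (se - sw) * (sn - ss)) *
  (2 * se * sn * Bx (Une Q) - 2 * sn * sw * Bx (Unw Q)
   + 2 * ss * sw * Bx (Usw Q) - 2 * ss * se * Bx (Use Q)
   - se * (Ez (Une Q) - Ez (Use Q)) + sw * (Ez (Unw Q) - Ez (Usw Q))
   - (se - sw) * (Ez_n lam Q - Ez_s lam Q)).

Definition By_ss (R : realType) (lam : wave_speeds R) (Q : riemann2d R) : R :=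
  let: (sw, se, ss, sn) := (Sw lam Q, Se lam Q, Ss lam Q, Sn lam Q) in
  1 / (2 * (se - sw) * (sn - ss)) *
  (2 * se * sn * By (Une Q) - 2 * sn * sw * By (Unw Q)
   + 2 * ss * sw * By (Usw Q) - 2 * ss * se * By (Use Q)
   + sn * (Ez (Une Q) - Ez (Unw Q)) - ss * (Ez (Use Q) - Ez (Usw Q))
   + (sn - ss) * (Ez_e lam Q - Ez_w lam Q)).

Definition Ez_ss (R : realType) (lam : wave_speeds R) (Q : riemann2d R) : R :=
  1 / 4 * (Ez_n lam Q + Ez_s lam Q + Ez_e lam Q + Ez_w lam Q)
  - 1 / 4 * Sn lam Q * (Bx_n Q - Bx_ss lam Q)
  - 1 / 4 * Ss lam Q * (Bx_s Q - Bx_ss lam Q)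
  + 1 / 4 * Se lam Q * (By_e Q - By_ss lam Q)
  + 1 / 4 * Sw lam Q * (By_w Q - By_ss lam Q).

Definition vertexEz (R : realType) (lam : wave_speeds R) (Q : riemann2d R) : R :=
  if 0 < Sw lam Q then Ez_w lam Q
  else if Se lam Q < 0 then Ez_e lam Q
  else if 0 < Ss lam Q then Ez_s lam Q
  else if Sn lam Q < 0 then Ez_n lam Q
  else Ez_ss lam Q.

(* Main.v *)
Require Import Defs.
From mathcomp Require Import all_boot all_order all_algebra.
From mathcomp Require Import reals ring lra.

Set Implicit Arguments.
Unset Strict Implicit.
Unset Printing Implicit Defensive.

Import Order.TTheory GRing.Theory Num.Theory.

Local Open Scope ring_scope.

(** When the data jump only across one coordinate direction, the 1-D problems
    along the other direction join a state to itself; the ordering of the wave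
    speeds makes the HLL field consistent, so these problems return the field
    of that state ([hllEz_x_const], [hllEz_y_const]).  The outermost speeds in
    the jump direction are those of the 1-D problem across the jump, so a test
    on them selects the same upwind field as that problem does; a test on the
    other two speeds selects a copy of the 1-D problem itself.  Hence every
    upwind branch of the 2-D solver yields the 1-D field.

    The remaining branch is the strongly interacting one.  The component of the
    magnetic field normal to the jump is constant there, and the tangential one
    collapses to the intermediate value [hll_B] of the 1-D solver ([Bx_ss_x],
    [By_ss_x] and their analogues in y).  The 1-D intermediate state satisfies
    the Rankine-Hugoniot conditions across both of its waves ([hll_jump_left],
    [hll_jump_right]), that is, the outer fields corrected by speed times
    magnetic jump both equal the 1-D field.  The vertex field averages four
    quantities, two being the 1-D field itself and two being these corrected
    outer fields, so it equals the 1-D field. *)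

(** * The one-dimensional HLL state and fields *)

Section HLLState.

Variables (R : realFieldType) (a b E1 E2 B1 B2 : R).

(** Both directions share these formulas: the induction equation reads
    d_t By = d_x Ez in direction x and d_t (- Bx) = d_y Ez in direction y, so
    the transported field is [B = By] in the former and [B = - Bx] in the
    latter, with flux [- Ez]. *)
Definition hll_E : R := (b * E1 - a * E2 - a * b * (B2 - B1)) / (b - a).
Definition hll_B : R := (b * B2 - a * B1 + (E2 - E1)) / (b - a).

(** The Rankine-Hugoniot condition across the wave of speed [a]. *)
Lemma hll_jump_left : a < b -> E1 + a * (B1 - hll_B) = hll_E.
Proof.
by move=> ab; rewrite /hll_E /hll_B; field; rewrite subr_eq0 gt_eqF.
Qed.

(** The Rankine-Hugoniot condition across the wave of speed [b]. *)
Lemma hll_jump_right : a < b -> E2 + b * (B2 - hll_B) = hll_E.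
Proof.
by move=> ab; rewrite /hll_E /hll_B; field; rewrite subr_eq0 gt_eqF.
Qed.

End HLLState.

Lemma hllEz_xE (R : realType) (lam : wave_speeds R) (UL UR : state R) :
  let SL := lambda_min lam dir_x UL UR in
  let SR := lambda_max lam dir_x UL UR in
  hllEz_x lam UL UR =
  if 0 < SL then Ez UL else if SR < 0 then Ez UR
  else hll_E SL SR (Ez UL) (Ez UR) (By UL) (By UR).
Proof. by rewrite /hllEz_x /hll_E (mulrC (lambda_min _ _ _ _)). Qed.

Lemma hllEz_yE (R : realType) (lam : wave_speeds R) (UD UU : state R) :
  let SD := lambda_min lam dir_y UD UU in
  let SU := lambda_max lam dir_y UD UU in
  hllEz_y lam UD UU =
  if 0 < SD then Ez UD else if SU < 0 then Ez UU
  else hll_E SD SU (Ez UD) (Ez UU) (- Bx UD) (- Bx UU).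
Proof. by rewrite /hllEz_y /hll_E -opprD mulrN opprK. Qed.

Lemma hll_E_const (R : realFieldType) (a b E B : R) :
  a < b -> hll_E a b E E B B = E.
Proof. by move=> ab; rewrite /hll_E; field; rewrite subr_eq0 gt_eqF. Qed.

Lemma hllEz_x_const (R : realType) (lam : wave_speeds R) (U : state R) :
  lambda_min lam dir_x U U < lambda_max lam dir_x U U ->
  hllEz_x lam U U = Ez U.
Proof. by move=> lt_lam; rewrite hllEz_xE hll_E_const // !if_same. Qed.

Lemma hllEz_y_const (R : realType) (lam : wave_speeds R) (U : state R) :
  lambda_min lam dir_y U U < lambda_max lam dir_y U U ->
  hllEz_y lam U U = Ez U.
Proof. by move=> lt_lam; rewrite hllEz_yE hll_E_const // !if_same. Qed.

Lemma min_lt_max (R : realDomainType) (a b c d : R) :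
  a < b -> Num.min a c < Num.max b d.
Proof. by move=> ab; rewrite gt_min !lt_max ab. Qed.

Section VertexField.

Variables (R : realType) (gamma : R) (lam : wave_speeds R).
Hypothesis lamP : ordered_speeds gamma lam.

(** * Jumps in the x direction only *)

Section JumpX.

Variables UL UR : state R.
Hypotheses (admL : admissible gamma UL) (admR : admissible gamma UR).
Hypothesis BxLR : Bx UL = Bx UR.

Let Q := Riemann2d UL UR UL UR.
Let SL := lambda_min lam dir_x UL UR.
Let SR := lambda_max lam dir_x UL UR.

Let ltSLSR : SL < SR. Proof. exact: lamP. Qed.

Let ltSsSn : Ss lam Q < Sn lam Q. Proof. exact/min_lt_max/lamP. Qed.

Lemma Sw_x : Sw lam Q = SL. Proof. exact: minxx. Qed.

Lemma Se_x : Se lam Q = SR. Proof. exact: maxxx. Qed.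

Lemma Ez_w_x : Ez_w lam Q = Ez UL. Proof. exact/hllEz_y_const/lamP. Qed.

Lemma Ez_e_x : Ez_e lam Q = Ez UR. Proof. exact/hllEz_y_const/lamP. Qed.

Lemma Bx_ss_x : Bx_ss lam Q = Bx UL.
Proof.
rewrite /Bx_ss Sw_x Se_x /Ez_n /Ez_s /= -BxLR.
by field; rewrite !subr_eq0 !gt_eqF.
Qed.

Lemma By_ss_x :
  By_ss lam Q = hll_B SL SR (Ez UL) (Ez UR) (By UL) (By UR).
Proof.
rewrite /By_ss /hll_B Ez_w_x Ez_e_x Sw_x Se_x /=.
by field; rewrite !subr_eq0 !gt_eqF.
Qed.

(** The hypothesis holds whenever the upwind tests of the 1-D solver fail.
    The groups [Ez_e + Se (By_e - By_ss)] and [Ez_w + Sw (By_w - By_ss)] of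
    [Ez_ss] equal the 1-D field by the Rankine-Hugoniot conditions, and the Bx
    terms vanish. *)
Lemma Ez_ss_x :
  hllEz_x lam UL UR = hll_E SL SR (Ez UL) (Ez UR) (By UL) (By UR) ->
  Ez_ss lam Q = hllEz_x lam UL UR.
Proof.
move=> EzE.
have jumpL := hll_jump_left (Ez UL) (Ez UR) (By UL) (By UR) ltSLSR.
have jumpR := hll_jump_right (Ez UL) (Ez UR) (By UL) (By UR) ltSLSR.
rewrite /Ez_ss Bx_ss_x By_ss_x Ez_w_x Ez_e_x Sw_x Se_x.
rewrite /Ez_n /Ez_s /Bx_n /Bx_s /By_e /By_w /= -BxLR EzE.
by rewrite !subrr; lra.
Qed.

Lemma vertexEz_x : vertexEz lam Q = hllEz_x lam UL UR.
Proof.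
rewrite /vertexEz Sw_x Se_x Ez_w_x Ez_e_x.
have := hllEz_xE lam UL UR; rewrite /= -/SL -/SR.
case: ifP => [_ -> //|_]; case: ifP => [_ -> //|_ EzE].
by rewrite Ez_ss_x // !if_same.
Qed.

End JumpX.

(** * Jumps in the y direction only *)

Section JumpY.

Variables UD UU : state R.
Hypotheses (admD : admissible gamma UD) (admU : admissible gamma UU).
Hypothesis ByDU : By UD = By UU.

Let Q := Riemann2d UD UD UU UU.
Let SD := lambda_min lam dir_y UD UU.
Let SU := lambda_max lam dir_y UD UU.

Let ltSDSU : SD < SU. Proof. exact: lamP. Qed.

Let ltSwSe : Sw lam Q < Se lam Q. Proof. exact/min_lt_max/lamP. Qed.

Lemma Ss_y : Ss lam Q = SD. Proof. exact: minxx. Qed.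

Lemma Sn_y : Sn lam Q = SU. Proof. exact: maxxx. Qed.

Lemma Ez_s_y : Ez_s lam Q = Ez UD. Proof. exact/hllEz_x_const/lamP. Qed.

Lemma Ez_n_y : Ez_n lam Q = Ez UU. Proof. exact/hllEz_x_const/lamP. Qed.

Lemma By_ss_y : By_ss lam Q = By UD.
Proof.
rewrite /By_ss Ss_y Sn_y /Ez_e /Ez_w /= -ByDU.
by field; rewrite !subr_eq0 !gt_eqF.
Qed.

Lemma Bx_ss_y :
  Bx_ss lam Q = - hll_B SD SU (Ez UD) (Ez UU) (- Bx UD) (- Bx UU).
Proof.
rewrite /Bx_ss /hll_B Ez_n_y Ez_s_y Ss_y Sn_y /=.
by field; rewrite !subr_eq0 !gt_eqF.
Qed.

Lemma Ez_ss_y :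
  hllEz_y lam UD UU = hll_E SD SU (Ez UD) (Ez UU) (- Bx UD) (- Bx UU) ->
  Ez_ss lam Q = hllEz_y lam UD UU.
Proof.
move=> EzE.
have jumpD := hll_jump_left (Ez UD) (Ez UU) (- Bx UD) (- Bx UU) ltSDSU.
have jumpU := hll_jump_right (Ez UD) (Ez UU) (- Bx UD) (- Bx UU) ltSDSU.
rewrite /Ez_ss Bx_ss_y By_ss_y Ez_n_y Ez_s_y Ss_y Sn_y.
rewrite /Ez_e /Ez_w /Bx_n /Bx_s /By_e /By_w /= -ByDU EzE.
by rewrite !subrr; lra.
Qed.

(** The tests on the x speeds come first, but they select a 1-D problem across
    the jump, whatever their outcome. *)
Lemma vertexEz_y : vertexEz lam Q = hllEz_y lam UD UU.
Proof.
rewrite /vertexEz /Ez_w /Ez_e /= Ss_y Sn_y Ez_s_y Ez_n_y.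
case: ifP => // _; case: ifP => // _.
have := hllEz_yE lam UD UU; rewrite /= -/SD -/SU.
case: ifP => [_ -> //|_]; case: ifP => [_ -> //|_ EzE].
exact: Ez_ss_y.
Qed.

End JumpY.

End VertexField.

Theorem mainTheorem1 (R : realType) (gamma : R) (lam : wave_speeds R)
    (Q : riemann2d R)
    (hgamma : 1 < gamma)
    (hlam : ordered_speeds gamma lam)
    (hsw : admissible gamma (Usw Q)) (hse : admissible gamma (Use Q))
    (hnw : admissible gamma (Unw Q)) (hne : admissible gamma (Une Q))
    (hB : normal_continuous Q) :
  (forall UL UR : state R,
     Unw Q = UL -> Usw Q = UL -> Une Q = UR -> Use Q = UR ->
     vertexEz lam Q = hllEz_x lam UL UR)
  /\
  (forall UD UU : state R,
     Usw Q = UD -> Use Q = UD -> Unw Q = UU -> Une Q = UU ->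
     vertexEz lam Q = hllEz_y lam UD UU).
Proof.
case: Q hsw hse hnw hne hB => sw se nw ne /= adm_sw adm_se adm_nw adm_ne.
case=> /= Bx_n_cont _ By_w_cont _; split.
  move=> UL UR nwE swE neE seE; subst nw sw ne se.
  exact: vertexEz_x hlam _ _ adm_sw adm_ne Bx_n_cont.
move=> UD UU swE seE nwE neE; subst sw se nw ne.
exact: vertexEz_y hlam _ _ adm_sw adm_ne By_w_cont.
Qed.
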